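(* Let $m \geq 1$ and $k \geq 1$ be integers and let $A$ be a finite alphabet of size at least $2$. Then the generic $A$-generated $k$-relation semigroup satisfies the small overlap condition $C(m)$, with respect to either the sum length stratification or the maximum length stratification. That is, for each of these two stratifications, the set of $A$-generated $k$-relation semigroup presentations satisfying $C(m)$ is generic in the set of all $A$-generated $k$-relation semigroup presentations.
   Context: Let $A^+$ denote the set of non-empty words over $A$. An $A$-generated $k$-relation semigroup presentation $\langle A \mid R\rangle$ consists of the finite alphabet $A$ and a finite sequence $R$ of $k$ ordered pairs of words $(u_1,v_1),\dots,(u_k,v_k) \in A^+\times A^+$. The words $u_1,v_1,\dots,u_k,v_k$ are the relation words; relation words at different positions count as different occurrences even if equal as words. A piece is a word which appears more than once as a factor (contiguous subword) in the relations, either as a factor of two different relation words, or as a factor of the same relation word in two different (possibly overlapping) places. The presentation satisfies $C(m)$ if no relation word can be written as a product of strictly fewer than $m$ pieces. Let $S$ be the set of $A$-generated $k$-relation semigroup presentations. The sum length (respectively, maximum length) stratification of $S$ is the sequence $(S_n)$ where $S_n$ is the finite set of presentations in $S$ whose sum of relation word lengths (respectively, length of longest relation word) is exactly $n$. A subset $X\subseteq S$ is generic if $\lim_{n\to\infty}|X\cap S_n|/|S_n|=1$. *)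

(* Defs.v *)
From mathcomp Require Export all_boot all_order all_algebra finmap.
From mathcomp Require Export all_classical all_reals all_analysis.

Set Implicit Arguments.
Unset Strict Implicit.
Unset Printing Implicit Defensive.

Import Order.TTheory GRing.Theory Num.Theory.
Export numFieldNormedType.Exports.

Local Open Scope classical_set_scope.
Local Open Scope ring_scope.

Definition nonempty_word (A : finType) : Type := {w : seq A | w != [::]}.

Definition presentation (A : finType) (k : nat) : Type :=
  k.-tuple (nonempty_word A * nonempty_word A).

Section Presentations.
Variables (A : finType) (k : nat).
Implicit Types (P : presentation A k) (w : seq A).

(* Relation words are indexed by position: [(i, true)] stands for u_i and
   [(i, false)] for v_i, so equal words at distinct positions stay distinct. *)
Definition relpos : finType := ('I_k * bool)%type.

Definition relword P (j : relpos) : seq A :=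
  let uv := tnth P j.1 in if j.2 then val uv.1 else val uv.2.

(* An occurrence of [w] is a relation word together with the offset at which
   [w] starts in it. *)
Definition occurs P w (o : relpos * nat) : Prop :=
  exists x y : seq A, size x = o.2 /\ relword P o.1 = x ++ w ++ y.

(* The empty word is a piece under this definition; being neutral for
   concatenation, it never helps to write a word with fewer pieces. *)
Definition piece P w : Prop :=
  exists o1 o2 : relpos * nat, [/\ o1 <> o2, occurs P w o1 & occurs P w o2].

Definition small_overlap (m : nat) P : Prop :=
  forall j : relpos,
    ~ exists ps : seq (seq A),
        [/\ (size ps < m)%N,
            forall w, w \in ps -> piece P w
          & relword P j = flatten ps].

Definition sum_length P : nat := (\sum_(j : relpos) size (relword P j))%N.

Definition max_length P : nat := (\max_(j : relpos) size (relword P j))%N.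

Definition sum_stratification (n : nat) : set (presentation A k) :=
  [set P | sum_length P = n].

Definition max_stratification (n : nat) : set (presentation A k) :=
  [set P | max_length P = n].

(* The strata are finite (lemmas below), so [fset_set] returns the actual finite
   set. An empty stratum yields the ratio 0 / 0 = 0; for the two
   stratifications above (with [k] positive and [A] nonempty) this only
   happens for finitely many [n]. *)
Definition generic (R : realType) (S : nat -> set (presentation A k))
    (X : set (presentation A k)) : Prop :=
  (#|` fset_set (X `&` S n)|%:R / #|` fset_set (S n)|%:R : R) @[n --> \oo]
    --> (1 : R).

Lemma finite_bounded_presentations (n : nat) :
  finite_set [set P | forall j, (size (relword P j) <= n)%N].
Proof.
pose f P : {ffun relpos -> n.-bseq A} :=
  [ffun j => insub_bseq n (relword P j)].
have injf : {in [set P | forall j, (size (relword P j) <= n)%N] &,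
    injective f}.
  move=> P Q; rewrite !inE /= => hP hQ /ffunP e.
  have e' j : relword P j = relword Q j.
    have := e j; rewrite !ffunE => /(congr1 val).
    by rewrite /insub_bseq /= !insubdK // unfold_in.
  apply: eq_from_tnth => i.
  have := e' (i, true); have := e' (i, false); rewrite /relword /=.
  case: (tnth P i) => a b; case: (tnth Q i) => c d /= h1 h2.
  by congr (_, _); apply: val_inj.
have := inj_card_eq injf; rewrite card_eq_le => /andP[_ le_f].
by apply: (card_le_finite le_f); exact: finite_finset.
Qed.

Lemma finite_sum_stratification (n : nat) : finite_set (sum_stratification n).
Proof.
apply: sub_finite_set (finite_bounded_presentations n) => P /= <- j.
by rewrite /sum_length (bigD1 j) //= leq_addr.
Qed.

Lemma finite_max_stratification (n : nat) : finite_set (max_stratification n).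
Proof.
apply: sub_finite_set (finite_bounded_presentations n) => P /= <- j.
exact: (leq_bigmax j).
Qed.

End Presentations.

(* Main.v *)
(* Fix the lengths of the [K = 2k] relation words, all at most [n]. If equal
   factors of length [t] start at two distinct positions, one of them can be
   deleted without losing information, so a proportion at most
   [(K (n + 1))^2 |A|^-t] of the presentations with these lengths have a
   repeated factor of length [t]. A relation word of length at least [m t] that
   is a product of fewer than [m] pieces contains a piece of length at least [t].
   Taking [t = 5 r] with [r] the integer square root of [n], the first proportion
   is [O(1/r)], and so is the proportion of presentations with a relation word
   shorter than [m t]: for the sum length, because letters can be moved to a short
   word from a long one; for the maximum length, because the number of words of
   given length grows geometrically. *)

From mathcomp Require Import zify ring.
Require Import Defs.

Set Implicit Arguments.
Unset Strict Implicit.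
Unset Printing Implicit Defensive.

Import Order.TTheory GRing.Theory Num.Theory.

Local Open Scope nat_scope.

(** * Deleting a window from a word, and counting words by length *)

Section Words.
Variable A : finType.
Implicit Types x y : seq A.

(* The windows may overlap: the letters of the deleted one are recovered from
   left to right. *)
Lemma cut_repeated_inj x y p o t :
  size x = size y -> p < o -> o + t <= size x ->
  take t (drop p x) = take t (drop o x) ->
  take t (drop p y) = take t (drop o y) ->
  take o x ++ drop (o + t) x = take o y ++ drop (o + t) y ->
  x = y.
Proof.
move=> exy po otx wx wy ecut.
have [a0 _|A0] := pickP (@predT A); last first.
  by case: x {ecut otx wx} exy => [|b ?]; [case: y {wy}|have := A0 b].
have ot : size (take o x) = size (take o y) by rewrite !size_take -exy.
have /eqP := ecut; rewrite eqseq_cat // => /andP[/eqP etake /eqP edrop].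
apply: (@eq_from_nth _ a0) => // i.
elim/ltn_ind: i => i IH ix.
have [io|oi] := ltnP i o.
  by rewrite -(nth_take a0 io x) etake nth_take.
have [ti|it] := leqP (o + t) i.
  have nthd z : nth a0 z i = nth a0 (drop (o + t) z) (i - (o + t)).
    by rewrite nth_drop subnKC.
  by rewrite !nthd edrop.
have jt : i - o < t by rewrite ltn_subLR.
(* A letter of the later window equals the letter [o - p] places before it. That place may lie in
   the window again, hence the strong induction on the position. *)
have shift z : take t (drop p z) = take t (drop o z) ->
    nth a0 z i = nth a0 z (p + (i - o)).
  move=> /(congr1 (fun s => nth a0 s (i - o))).
  by rewrite !nth_take // !nth_drop subnKC // => ->.
rewrite (shift x) // (shift y) //; apply: IH; lia.
Qed.

Lemma cut_known_inj x y o t :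
  size x = size y -> take t (drop o x) = take t (drop o y) ->
  take o x ++ drop (o + t) x = take o y ++ drop (o + t) y ->
  x = y.
Proof.
move=> exy ewin ecut.
have ot : size (take o x) = size (take o y) by rewrite !size_take -exy.
have /eqP := ecut; rewrite eqseq_cat // => /andP[/eqP etake /eqP edrop].
rewrite -(cat_take_drop o x) -(cat_take_drop o y) etake.
rewrite -(cat_take_drop t (drop o x)) -(cat_take_drop t (drop o y)) ewin.
by rewrite !drop_drop addnC edrop.
Qed.

Lemma size_cut x o t :
  o + t <= size x -> size (take o x ++ drop (o + t) x) = size x - t.
Proof. by move=> h; rewrite size_cat size_take_min size_drop; lia. Qed.

Lemma card_bseq_size n l :
  l <= n -> #|[set w : n.-bseq A | size w == l]| = #|A| ^ l.
Proof.
move=> ln; rewrite -card_tuple.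
pose g (w : l.-tuple A) : n.-bseq A := insub_bseq n w.
have gK w : g w = w :> seq A.
  by rewrite /g /insub_bseq insubdK // unfold_in size_tuple.
have ginj : injective g.
  by move=> v w /(congr1 val) /=; rewrite !gK => /val_inj.
rewrite -(card_imset _ ginj); apply: eq_card => w; rewrite inE.
apply/eqP/imsetP => [wl|[v _ ->]]; last by rewrite gK size_tuple.
exists (tcast wl (in_tuple w)); first by [].
by apply: val_inj; rewrite /= gK val_tcast.
Qed.

Lemma card_bseq_lt n s : 1 < #|A| ->
  #|[set w : n.-bseq A | size w < s]| <= #|A| ^ s.
Proof.
move=> A2.
(* The strict inequality is what the induction carries: with at least two letters, the geometric sum
   of [#|A| ^ l] over [l < s] stays below [#|A| ^ s]. *)
suff : #|[set w : n.-bseq A | size w < s]| < #|A| ^ s by exact: ltnW.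
elim: s => [|s IH].
  by rewrite expn0 eq_card0 // => w; rewrite inE.
have -> : [set w : n.-bseq A | size w < s.+1] =
    [set w : n.-bseq A | size w < s] :|: [set w : n.-bseq A | size w == s].
  by apply/setP => w; rewrite !inE ltnS leq_eqVlt orbC.
apply: leq_ltn_trans (leq_card_setU _ _) _.
have h2 : #|[set w : n.-bseq A | size w == s]| <= #|A| ^ s.
  have [sn|ns] := leqP s n; first by rewrite card_bseq_size.
  rewrite eq_card0 // => w; rewrite inE; apply/negbTE.
  by rewrite neq_ltn (leq_ltn_trans (size_bseq w) ns).
rewrite expnS; nia.
Qed.

End Words.

(** * Families of words sorted by their vector of lengths *)

Section Families.
Variables (A : finType) (I : finType) (n : nat).
Hypothesis A2 : 1 < #|A|.
Local Notation fam := {ffun I -> n.-bseq A}.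
Local Notation lens := {ffun I -> 'I_n.+1}.
Implicit Types (f g : fam) (l : lens) (L : {set lens}).

Lemma card_family_prod (F : I -> pred (n.-bseq A)) :
  #|[set f : fam | [forall i, F i (f i)]]| = \prod_i #|F i|.
Proof.
transitivity #|family F|.
  by apply: eq_card => f; rewrite inE; apply/forallP/familyP => h i; exact: h.
by rewrite card_family foldrE big_map big_enum.
Qed.

Lemma card_fixed_sizes (l : I -> nat) : (forall i, l i <= n) ->
  #|[set f : fam | [forall i, size (f i) == l i]]| = #|A| ^ \sum_i l i.
Proof.
move=> ln; rewrite (card_family_prod (fun i w => size w == l i)) expn_sum.
by apply: eq_bigr => i _; rewrite -(card_bseq_size A (ln i)) cardsE.
Qed.

Local Notation words f := (fun i => f i : seq A).

Definition lengths f : lens := [ffun i => inord (size (f i))].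

Lemma lengthsE f i : lengths f i = size (f i) :> nat.
Proof. by rewrite ffunE inordK // ltnS size_bseq. Qed.

Definition stratum L : {set fam} := [set f | lengths f \in L].

Lemma card_fiber l : #|[set f | lengths f == l]| = #|A| ^ \sum_i l i.
Proof.
rewrite -(@card_fixed_sizes (fun i => l i)); last by move=> i; rewrite -ltnS.
apply: eq_card => f; rewrite !inE; apply/eqP/forallP => [<- i|h].
  by rewrite lengthsE.
by apply/ffunP => i; apply: val_inj; rewrite /= lengthsE (eqP (h i)).
Qed.

Lemma card_setI_stratum L (P : pred fam) :
  #|[set f in stratum L | P f]| =
  \sum_(l in L) #|[set f | (lengths f == l) && P f]|.
Proof.
rewrite -sum1_card (partition_big lengths (fun l => l \in L)); last first.
  by move=> f; rewrite !inE => /andP[].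
apply: eq_bigr => l lL; rewrite -sum1_card; apply: eq_bigl => f.
by rewrite !inE; case: eqP => [->|_]; rewrite ?andbF ?andbT // lL.
Qed.

Lemma card_stratum L : #|stratum L| = \sum_(l in L) #|A| ^ \sum_i l i.
Proof.
have -> : stratum L = [set f in stratum L | predT f].
  by apply/setP => f; rewrite !inE andbT.
rewrite card_setI_stratum; apply: eq_bigr => l _; rewrite -card_fiber.
by apply: eq_card => f; rewrite !inE andbT.
Qed.


(** * Families with a repeated factor *)

Definition window_at (g : I -> seq A) t (o : I * nat) : seq A :=
  take t (drop o.2 (g o.1)).

(** The two size bounds rule out windows that [take] would truncate at the end of a word. Stating
    this for functions into [seq A] lets it apply to families and to [relword P] alike. *)
Definition repeated (t : nat) (g : I -> seq A) (o1 o2 : I * nat) : bool :=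
  [&& o1 != o2, o1.2 + t <= size (g o1.1), o2.2 + t <= size (g o2.1)
    & window_at g t o1 == window_at g t o2].

Definition has_repeat t (g : I -> seq A) : Prop :=
  exists o1 o2, repeated t g o1 o2.

(** Deleting the window at [o2] is injective on these families, and its images have total length
    smaller by [t]. *)
Lemma card_fiber_repeated l t (o1 o2 : I * nat) :
  #|[set f | (lengths f == l) && repeated t (words f) o1 o2]| * #|A| ^ t <=
  #|A| ^ \sum_i l i.
Proof.
(* If both windows lie in one word, the later one is to be deleted, since its letters are recovered
   from earlier ones. In different words the order is immaterial. *)
wlog lt12 : o1 o2 / (o1.1 == o2.1) ==> (o1.2 < o2.2).
  move=> wl; have [/wl //|] := boolP ((o1.1 == o2.1) ==> (o1.2 < o2.2)).
  rewrite negb_imply -leqNgt => /andP[/eqP e1 le21].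
  have [e2|ne2] := eqVneq o1.2 o2.2.
    rewrite eq_card0 ?mul0n // => f; rewrite inE /repeated -pair_eqE /pair_eq.
    by rewrite e1 e2 !eqxx andbF.
  have -> : [set f | (lengths f == l) && repeated t (words f) o1 o2] =
      [set f | (lengths f == l) && repeated t (words f) o2 o1].
    apply/setP => f; rewrite !inE /repeated (eq_sym o1)
      [window_at _ _ _ == _]eq_sym.
    by rewrite [X in _ && (_ && X)]andbCA.
  by apply: wl; rewrite e1 eqxx ltn_neqAle eq_sym ne2.
set Z := [set f | _].
(* A member of [Z] certifies that [t] fits into [l j], so that the subtraction in [l'] below is not
   truncated. *)
have [->|[f0 f0Z]] := set_0Vmem Z; first by rewrite cards0.
pose j := o2.1.
have lj f : f \in Z -> o2.2 + t <= l j.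
  by rewrite inE => /andP[/eqP <- /and4P[]]; rewrite lengthsE.
pose l' i := if i == j then l i - t else l i.
have suml : (\sum_i l i = t + \sum_i l' i).
  rewrite (bigD1 j) //= [in RHS](bigD1 j) //= {1}/l' eqxx addnA.
  rewrite subnKC; last by have := lj _ f0Z; lia.
  by congr (_ + _); apply: eq_bigr => i /negbTE ne; rewrite /l' ne.
rewrite suml addnC expnD leq_pmul2r ?expn_gt0 ?(ltnW A2) //.
rewrite -card_fixed_sizes; last first.
  by move=> i; rewrite /l'; have := ltn_ord (l i); case: ifP; lia.
pose cutw (w : n.-bseq A) := take o2.2 w ++ drop (o2.2 + t) w.
pose cut f : fam :=
  [ffun i => if i == j then insub_bseq n (cutw (f i)) else f i].
have cutE f : f \in Z -> cut f j = cutw (f j) :> seq A.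
  move=> fZ; rewrite ffunE eqxx /insub_bseq insubdK // unfold_in.
  move: fZ; rewrite inE => /andP[_ /and4P[_ _ h _]].
  by rewrite /cutw size_cut // (leq_trans (leq_subr _ _)) // size_bseq.
rewrite -(@card_in_imset _ _ cut Z).
  apply: subset_leq_card; apply/fintype.subsetP => _ /imsetP[f fZ ->].
  rewrite inE; apply/forallP => i; rewrite /l'.
  have [->|/negbTE ne] := eqVneq i j.
    rewrite cutE // /cutw size_cut.
      by move: fZ; rewrite inE => /andP[/eqP <- _]; rewrite lengthsE.
    by move: fZ; rewrite inE => /andP[_ /and4P[]].
  rewrite ffunE ne; move: fZ; rewrite inE => /andP[/eqP <- _].
  by rewrite lengthsE.
move=> f g fZ gZ ecut.
have ecutj : cutw (f j) = cutw (g j) by rewrite -!cutE // ecut.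
have eother i : i != j -> f i = g i.
  by move=> /negbTE ne; have := congr1 (fun h : fam => h i) ecut;
    rewrite !ffunE ne.
have esize : size (f j) = size (g j).
  move: fZ gZ; rewrite !inE -!lengthsE => /andP[/eqP -> _].
  by move=> /andP[/eqP -> _].
apply/ffunP => i; have [->|/eother //] := eqVneq i j.
move: fZ gZ; rewrite !inE => /andP[_ /and4P[_ _ hf /eqP wf]].
move=> /andP[_ /and4P[_ _ hg /eqP wg]].
(* Within one word the deleted window is rebuilt from left to right; otherwise its copy survives
   intact in another word, on which [f] and [g] agree. *)
apply: val_inj => /=; have [e1|ne1] := eqVneq o1.1 j.
  move: lt12; rewrite e1 eqxx /= => lt12; rewrite /window_at e1 in wf wg.
  exact: (cut_repeated_inj esize lt12 hf wf wg).
apply: (cut_known_inj esize _ ecutj); rewrite -/(window_at (words f) t o2).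
rewrite -[RHS]/(window_at (words g) t o2) -wf -wg /window_at.
by rewrite eother.
Qed.

(** Union bound over pairs of positions: each has [#|I|] choices of word and at most [n.+1] of
    offset. *)
Lemma card_stratum_repeat L t : 0 < t ->
  #|[set f in stratum L | `[< has_repeat t (words f) >]]| * #|A| ^ t <=
  (#|I| * n.+1) ^ 2 * #|stratum L|.
Proof.
move=> t0; rewrite card_setI_stratum card_stratum big_distrl big_distrr /=.
apply: leq_sum => l _.
pose T := (I * 'I_n.+1)%type.
pose u (o : T) : I * nat := (o.1, o.2 : nat).
pose B (o : T * T) :=
  [set f | (lengths f == l) && repeated t (words f) (u o.1) (u o.2)].
have sub : [set f | (lengths f == l) && `[< has_repeat t (words f) >]]
    \subset \bigcup_o B o.
  apply/fintype.subsetP => f; rewrite inE.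
  move=> /andP[fl /asboolP[[i1 p1] [[i2 p2]]] rep].
  have := rep; rewrite /repeated => /and4P[_ /= h1 h2 _].
  have h1' : p1 < n.+1.
    by rewrite ltnS (leq_trans (leq_trans (leq_addr t _) h1)) ?size_bseq.
  have h2' : p2 < n.+1.
    by rewrite ltnS (leq_trans (leq_trans (leq_addr t _) h2)) ?size_bseq.
  apply/bigcupP; exists ((i1, Ordinal h1'), (i2, Ordinal h2')) => //.
  by rewrite inE fl.
apply: (@leq_trans ((\sum_o #|B o|) * #|A| ^ t)).
  rewrite leq_mul2r; apply/orP; right; apply: leq_trans (subset_leq_card sub) _.
  elim/big_ind2: _ => [|p P q Q h1 h2|//]; first by rewrite cards0.
  by apply: leq_trans (leq_card_setU _ _) _; apply: leq_add.
rewrite big_distrl /=; apply: (@leq_trans (\sum_(o : T * T) #|A| ^ \sum_i l i)).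
  by apply: leq_sum => o _; exact: card_fiber_repeated.
by rewrite sum_nat_const card_prod card_prod card_ord mulnn.
Qed.

(** * Families with a short word, for a given sum of lengths *)

Definition sum_lengths : {set lens} :=
  [set l : lens | [forall i, 0 < l i] && (\sum_i l i == n)].

Definition max_lengths : {set lens} :=
  [set l : lens | [forall i, 0 < l i] && (\max_i l i == n)].

(* Moving [i < M] letters from the long word [j'] to the word [j]. *)
Lemma card_sum_lengths_shift j j' r M : j != j' ->
  #|[set l in sum_lengths | (l j == r :> nat) && (M <= l j')]| * M <=
  #|sum_lengths|.
Proof.
move=> jj'; set Z := [set l in _ | _].
rewrite -[X in _ * X]card_ord -cardsT -cardsX.
pose mv (u : lens * 'I_M) : lens := [ffun x =>
  if x == j then inord (u.1 x + u.2) else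
  if x == j' then inord (u.1 x - u.2) else u.1 x].
have sumE (h : I -> nat) :
    \sum_i h i = h j + (h j' + \sum_(i | (i != j) && (i != j')) h i).
  by rewrite (bigD1 j) //= (bigD1 j') //= eq_sym.
(* The inequality [i < l j'] keeps the shortened word nonempty, and [l j + i <= n] makes [inord]
   exact. *)
have bnd l (i : 'I_M) : l \in Z -> [/\ l j + i <= n, i < l j',
    \sum_x l x = n, l j = r :> nat & forall x, 0 < l x].
  rewrite !inE => /andP[/andP[/forallP lp /eqP ln] /andP[/eqP lr Ml]].
  have := ltn_ord i; move: ln; rewrite sumE => ln iM.
  split => //; [|exact: leq_trans iM Ml].
  by rewrite -[leqRHS]ln leq_add2l (leq_trans (ltnW iM)) //
    (leq_trans Ml) ?leq_addr.
have mvj l i : l \in Z -> mv (l, i) j = l j + i :> nat.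
  by case/(bnd _ i) => h _ _ _ _; rewrite ffunE eqxx inordK.
have mvj' l i : l \in Z -> mv (l, i) j' = l j' - i :> nat.
  move=> _; rewrite ffunE eq_sym (negbTE jj') eqxx inordK //=.
  by have := ltn_ord (l j'); lia.
have mvx l i x : (x != j) && (x != j') -> mv (l, i) x = l x.
  by case/andP => /negbTE h1 /negbTE h2; rewrite ffunE h1 h2.
rewrite -(@card_in_imset _ _ mv).
  apply: subset_leq_card; apply/fintype.subsetP => _ /imsetP[[l i] + ->].
  rewrite !finset.in_setX => /andP[lZ _]; have [h1 h2 h3 h4 h5] := bnd _ i lZ.
  rewrite inE; apply/andP; split.
    apply/forallP => x; have [->|xj] := eqVneq x j.
      by rewrite mvj // ltn_addr.
    have [->|xj'] := eqVneq x j'; first by rewrite mvj' // subn_gt0.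
    by rewrite mvx // xj.
  rewrite -[X in _ == X]h3 !sumE mvj // mvj' //.
  have -> : \sum_(x | (x != j) && (x != j')) mv (l, i) x =
      \sum_(x | (x != j) && (x != j')) l x.
    by apply: eq_bigr => x /mvx ->.
  by rewrite -addnA (addnA (nat_of_ord i)) subnKC // ltnW.
move=> [l i] [l' i']; rewrite !finset.in_setX => /andP[lZ _] /andP[lZ' _] e.
have [_ h2 _ h4 _] := bnd _ i lZ; have [_ h2' _ h4' _] := bnd _ i' lZ'.
have ej := mvj _ i lZ; have ej' := mvj' _ i lZ.
rewrite e mvj // in ej; rewrite e mvj' // in ej'.
(* Both vectors have the value [r] at [j] before the move, so the new value there reveals the number
   of letters moved. *)
have ei : i = i' by apply: val_inj => /=; lia.
subst i'; congr (_, _); apply/ffunP => x; apply: val_inj => /=.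
have [->|xj] := eqVneq x j; first by lia.
have [->|xj'] := eqVneq x j'; first by lia.
by rewrite -(mvx l i) ?xj // e mvx // xj.
Qed.

Lemma card_bigcup_leq (T U : finType) (B : T -> {set U}) (P : pred T) c :
  (forall o, P o -> #|B o| <= c) -> #|\bigcup_(o | P o) B o| <= #|T| * c.
Proof.
move=> h; apply: (@leq_trans (\sum_(o | P o) c)).
  elim/big_ind2: _ => [|p X q Y h1 h2|]; first by rewrite cards0.
    by apply: leq_trans (leq_card_setU _ _) _; apply: leq_add.
  exact: h.
by rewrite sum_nat_const leq_mul2r max_card orbT.
Qed.

(** If one length is below [s], another is at least [M], for otherwise the sum would be less than
    [#|I| * M + s]. The shift then applies to each of the at most [#|I| ^ 2 * s] choices of the two
    words and the short length. *)
Lemma card_sum_lengths_short s M : #|I| * M + s <= n ->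
  #|[set l in sum_lengths | [exists j, l j < s]]| * M <=
  #|I| ^ 2 * s * #|sum_lengths|.
Proof.
move=> hM; case: M hM => [|M] hM; first by rewrite muln0.
pose T := ((I * I) * 'I_s)%type.
pose B (o : T) := [set l in sum_lengths |
  (l o.1.1 == o.2 :> nat) && (M.+1 <= l o.1.2)].
have sub : [set l in sum_lengths | [exists j, l j < s]] \subset
    \bigcup_(o : T | o.1.1 != o.1.2) B o.
  apply/fintype.subsetP => l; rewrite inE => /andP[lS /existsP[j js]].
  have [/existsP[j' /andP[jj' Mj']]|/existsPn no] :=
      boolP [exists j', (j != j') && (M < l j')].
    by apply/bigcupP; exists ((j, j'), Ordinal js) => //=; rewrite inE lS eqxx.
  have : \sum_i l i = n by move: lS; rewrite inE => /andP[_ /eqP].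
  rewrite (bigD1 j) //=.
  have : \sum_(i | i != j) l i <= \sum_(i | i != j) M.
    apply: leq_sum => i ij; have := no i; rewrite eq_sym ij /= -leqNgt.
    exact.
  have : \sum_(i | i != j) M <= #|I| * M.
    by rewrite sum_nat_const leq_mul2r max_card orbT.
  move=> h1 h2 h3; have : l j + \sum_(i | i != j) l i < s + #|I| * M.
    by rewrite -addSn leq_add // (leq_trans h2).
  by rewrite h3 ltnNge (leq_trans _ hM) // addnC leq_add2r leq_mul2l leqnSn
    orbT.
apply: (@leq_trans (#|\bigcup_(o : T | o.1.1 != o.1.2) B o| * M.+1)).
  by rewrite leq_mul2r (subset_leq_card sub) orbT.
apply: (@leq_trans ((#|{: (I * I) * 'I_s}| * (#|sum_lengths| %/ M.+1)) * M.+1)).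
  rewrite leq_mul2r; apply/orP; right; apply: card_bigcup_leq => o oo.
  by rewrite leq_divRL // card_sum_lengths_shift.
rewrite !card_prod card_ord mulnn -mulnA leq_mul2l leq_trunc_div orbT //.
Qed.

(** All vectors of sum [n] carry the same number of families, so proportions of families become
    proportions of vectors. *)
Lemma card_stratum_sum L : L \subset sum_lengths ->
  #|stratum L| = #|L| * #|A| ^ n.
Proof.
move=> /fintype.subsetP LS; rewrite card_stratum // -sum_nat_const.
by apply: eq_bigr => l /LS; rewrite inE => /andP[_ /eqP ->].
Qed.

Lemma sum_stratum_short s M : #|I| * M + s <= n ->
  #|[set f in stratum sum_lengths | [exists j, size (f j) < s]]| * M <=
  #|I| ^ 2 * s * #|stratum sum_lengths|.
Proof.
move=> /card_sum_lengths_short h.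
have -> : [set f in stratum sum_lengths | [exists j, size (f j) < s]] =
    stratum [set l in sum_lengths | [exists j, l j < s]].
  apply/setP => f; rewrite !inE; congr (_ && _).
  by apply: eq_existsb => j; rewrite lengthsE.
rewrite !card_stratum_sum //.
  by rewrite mulnAC [leqRHS]mulnA leq_mul2r h orbT.
by apply/fintype.subsetP => l; rewrite inE => /andP[].
Qed.

Lemma sum_stratum_gt0 : 0 < #|I| -> #|I| <= n -> 0 < #|stratum sum_lengths|.
Proof.
move=> I0 In; rewrite card_stratum_sum // muln_gt0 expn_gt0 (ltnW A2) /= andbT.
have /card_gt0P[j _] := I0.
(* All words have one letter except the [j]-th, which takes the remaining length. *)
apply/card_gt0P; exists [ffun i => inord (if i == j then n - #|I|.-1 else 1)].
have E i : ([ffun i => inord (if i == j then n - #|I|.-1 else 1)] : lens) i =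
    (if i == j then n - #|I|.-1 else 1) :> nat.
  by rewrite ffunE inordK //; case: ifP => _; lia.
rewrite inE; apply/andP; split.
  by apply/forallP => i; rewrite E; case: ifP; rewrite // subn_gt0 prednK.
rewrite (eq_bigr _ (fun i _ => E i)) (bigD1 j) //= eqxx.
rewrite (eq_bigr (fun=> 1)); last by move=> i /negbTE ->.
rewrite sum1_card.
by rewrite (cardC1 j) subnK // (leq_trans (leq_pred _)).
Qed.

(** * Families with a short word, for a given maximum length *)

Lemma card_max_stratum : 0 < #|I| -> 0 < n ->
  #|A| ^ (#|I| * n) <= #|stratum max_lengths|.
Proof.
move=> I0 n0; rewrite card_stratum //.
pose l : lens := [ffun => ord_max].
have lE i : l i = n :> nat by rewrite ffunE.
have lL : l \in max_lengths.
  rewrite inE; apply/andP; split; first by apply/forallP => i; rewrite lE.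
  rewrite (eq_bigr _ (fun i _ => lE i)).
  have /card_gt0P[j _] := I0.
  by rewrite eqn_leq (leq_bigmax j) andbT; apply/bigmax_leqP.
rewrite (bigD1 l) //= (eq_bigr _ (fun i _ => lE i)) sum_nat_const.
by rewrite leq_addr.
Qed.

(** Once the short word is chosen, it has at most [#|A| ^ s] values, and each other word has at most
    [#|A| ^ n.+1], being of any length up to [n]. *)
Lemma card_short s :
  #|[set f : fam | [exists j, size (f j) < s]]| <=
  #|I| * (#|A| ^ (n.+1 * #|I|.-1 + s)).
Proof.
have -> : [set f : fam | [exists j, size (f j) < s]] =
   \bigcup_j [set f : fam | size (f j) < s].
  apply/setP => f; rewrite inE; apply/existsP/bigcupP => [[j h]|[j _]].
    by exists j => //; rewrite inE.
  by rewrite inE; exists j.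
apply: card_bigcup_leq => j _.
pose F i : pred (n.-bseq A) := fun w => (i == j) ==> (size w < s).
have -> : [set f : fam | size (f j) < s] =
    [set f : fam | [forall i, F i (f i)]].
  apply/setP => f; rewrite !inE; apply/idP/forallP => [h i|/(_ j)].
    by apply/implyP => /eqP ->.
  by rewrite /F eqxx.
rewrite card_family_prod (bigD1 j) //= expnD mulnC; apply: leq_mul.
  rewrite expnM -(cardC1 j) -prod_nat_const; apply: leq_prod => i _.
  have e : [set w : n.-bseq A | size w < n.+1] =i {: n.-bseq A}.
    by move=> w; rewrite !inE ltnS size_bseq.
  apply: leq_trans (max_card _) _.
  by rewrite -(eq_card e) card_bseq_lt.
apply: leq_trans (card_bseq_lt n s A2); rewrite cardsE.
by apply: eq_leq; apply: eq_card => w; rewrite !unfold_in /F eqxx.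
Qed.

Lemma max_stratum_short s r : 0 < #|I| -> 0 < n -> s + r <= n ->
  #|[set f in stratum max_lengths | [exists j, size (f j) < s]]| * r <=
  #|I| * #|A| ^ #|I| * #|stratum max_lengths|.
Proof.
move=> I0 n0 srn.
have a0 : 0 < #|A| by exact: ltnW.
set X := #|_|; have hX : X <= #|I| * (#|A| ^ (n.+1 * #|I|.-1 + s)).
  apply: leq_trans (card_short s); apply: subset_leq_card.
  by apply/fintype.subsetP => f; rewrite !inE => /andP[].
have hr : r <= #|A| ^ r by rewrite ltnW // ltn_expl.
apply: leq_trans (leq_mul hX hr) _; rewrite -!mulnA leq_mul2l -expnD.
apply/orP; right.
(* As [s + r <= n], the exponent [n.+1 * #|I|.-1 + s + r] is at most [#|I| * n.+1]. The excess
   [#|I|] over the exponent in [card_max_stratum] becomes the constant [#|A| ^ #|I|]. *)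
apply: (@leq_trans (#|A| ^ (#|I| + #|I| * n))); last first.
  by rewrite expnD leq_mul2l card_max_stratum // orbT.
by rewrite leq_exp2l //; case: #|I| I0 => // K _ /=; nia.
Qed.

End Families.

(** * Explicit decay of the exceptional proportion *)

Section Rates.
Variables (A : finType) (I : finType).
Hypotheses (A2 : 1 < #|A|) (I0 : 0 < #|I|).
Local Notation lens n := {ffun I -> 'I_n.+1}.

Definition bad n (L : {set lens n}) m t : {set {ffun I -> n.-bseq A}} :=
  [set f in stratum A L | [exists j, size (f j) < m * t]] :|:
  [set f in stratum A L | `[< has_repeat t (fun i => f i : seq A) >]].

Lemma bad_rate n (L : {set lens n}) m r C : 0 < r -> n < r.+1 ^ 2 ->
  #|[set f in stratum A L | [exists j, size (f j) < m * (5 * r)]]| * r <=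
    C * #|stratum A L| ->
  #|bad L m (5 * r)| * r <= (C + 16 * #|I| ^ 2) * #|stratum A L|.
Proof.
move=> r0 nr hshort.
apply: leq_trans (leq_mul (leq_card_setU _ _) (leqnn r)) _.
rewrite mulnDl [leqRHS]mulnDl; apply: leq_add => //.
have t0 : 0 < 5 * r by rewrite muln_gt0.
have := card_stratum_repeat A2 L t0.
set rep := #|_|; set S := #|_| => hrep.
have ar : r ^ 5 <= #|A| ^ (5 * r).
  by rewrite mulnC expnM leq_exp2r // ltnW // ltn_expl.
have nS : n.+1 <= 4 * r ^ 2.
  by apply: leq_trans nr _; rewrite -[4]/(2 ^ 2) -expnMn leq_exp2r //; lia.
have a0 : 0 < #|A| ^ (5 * r) by rewrite expn_gt0 ltnW.
rewrite -(leq_pmul2r a0) mulnAC.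
apply: (@leq_trans (((#|I| * n.+1) ^ 2 * S) * r)).
  by rewrite leq_mul2r hrep orbT.
apply: (@leq_trans ((#|I| * (4 * r ^ 2)) ^ 2 * S * r)).
  by rewrite !leq_mul2r leq_exp2r // leq_mul2l nS !orbT.
apply: (@leq_trans (16 * #|I| ^ 2 * S * r ^ 5));
  last by rewrite leq_mul2l ar orbT.
by apply: eq_leq; ring.
Qed.

(** Division-free form of a bad proportion at most [C / r], with [C] independent of [n] and [r] the
    integer square root of [n]. *)
Definition rare (L : forall n, {set lens n}) m : Prop :=
  exists C r0, forall n r, r0 <= r -> r ^ 2 <= n -> n < r.+1 ^ 2 ->
    0 < #|stratum A (L n)| /\
    #|bad (L n) m (5 * r)| * r <= C * #|stratum A (L n)|.

Lemma rare_sum m : rare (@sum_lengths I) m.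
Proof.
exists (20 * m * #|I| ^ 3 + 16 * #|I| ^ 2), (10 * m + 2 * #|I| + 1).
move=> n r hr rn nr.
set K := #|I| in hr *; have K0 : 0 < K by exact: I0.
have hKn : 2 * K <= n by apply: leq_trans rn; nia.
split; first by apply: sum_stratum_gt0 => //; lia.
apply: bad_rate => //; first by lia.
(* This choice gives [K * M] at most half of [n], and [10 * m <= r] leaves the other half for
   [m * (5 * r)]. Conversely [n <= 4 * K * M], whence [M] is at least of order [r ^ 2]. *)
set M := n %/ (2 * K).
have M1 : 0 < M by rewrite divn_gt0 ?muln_gt0 //= K0.
have Mn : M * (2 * K) <= n by exact: leq_trunc_div.
have nM : n < M.+1 * (2 * K) by rewrite ltn_ceil // muln_gt0.
have hs : K * M + m * (5 * r) <= n by nia.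
have := sum_stratum_short A2 hs; rewrite -/K.
set X := #|_|; set S := #|_| => h.
rewrite -(leq_pmul2r M1) mulnAC.
apply: (@leq_trans (K ^ 2 * (m * (5 * r)) * S * r)).
  by rewrite leq_mul2r h orbT.
apply: (@leq_trans (K ^ 2 * (m * 5) * S * r ^ 2)).
  by apply: eq_leq; ring.
apply: (@leq_trans (K ^ 2 * (m * 5) * S * (4 * K * M))).
  by rewrite leq_mul2l; apply/orP; right; apply: leq_trans rn _; nia.
by apply: eq_leq; ring.
Qed.

Lemma rare_max m : rare (@max_lengths I) m.
Proof.
exists (#|I| * #|A| ^ #|I| + 16 * #|I| ^ 2), (5 * m + 1) => n r hr rn nr.
have r0 : 0 < r by lia.
have n0 : 0 < n by apply: leq_trans rn; rewrite expn_gt0 r0.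
split.
  by apply: leq_trans (card_max_stratum _ I0 n0); rewrite expn_gt0 ltnW.
apply: bad_rate => //; apply: max_stratum_short => //.
(* The threshold [5 * m + 1] is what makes [m * (5 * r) + r <= r ^ 2]. *)
by apply: leq_trans rn; nia.
Qed.

End Rates.

(** * From families of words back to presentations *)

Section Presentations.
Variables (A : finType) (k : nat).
Hypotheses (A2 : 1 < #|A|) (k0 : 0 < k).
Local Notation I := (relpos k).
Implicit Types P : presentation A k.

Lemma card_relpos_gt0 : 0 < #|I|.
Proof. by rewrite card_prod card_ord card_bool muln_gt0 k0. Qed.

Lemma relword_gt0 P j : 0 < size (relword P j).
Proof.
rewrite /relword; case: (tnth P j.1) => u v /=.
by case: ifP => _; rewrite lt0n size_eq0; [exact: (valP u)|exact: (valP v)].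
Qed.

Lemma occurs_window P w (o : I * nat) t : occurs P w o -> t <= size w ->
  o.2 + t <= size (relword P o.1) /\ window_at (relword P) t o = take t w.
Proof.
case=> x [y [ox e]] tw; rewrite /window_at e -ox !size_cat; split; first by lia.
by rewrite drop_size_cat // takel_cat.
Qed.

(** Fewer than [m] pieces covering at least [m * t] letters cannot all be shorter than [t]. Two
    distinct occurrences of a long piece, cut to their first [t] letters, form the repeat. *)
Lemma has_repeat_of_not_small_overlap m t P : 0 < t ->
  (forall j, m * t <= size (relword P j)) -> ~ small_overlap m P ->
  has_repeat t (relword P).
Proof.
move=> t0 long /existsNP[j /contrapT[ps [psm pieces eps]]].
have [w wps tw] : exists2 w, w \in ps & t <= size w.
  apply/hasP; rewrite -[has _ _]negbK -all_predC; apply/negP => /allP small.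
  have : size (flatten ps) <= size ps * t.
    rewrite size_flatten /shape sumnE big_map big_seq.
    apply: (@leq_trans (\sum_(i <- ps | i \in ps) t)).
      by apply: leq_sum => i /small /=; rewrite -ltnNge => /ltnW.
    by rewrite -big_seq big_const_seq count_predT iter_addn_0 mulnC.
  by rewrite -eps; have := long j; nia.
have [p1 [p2 [ne12 oc1 oc2]]] := pieces _ wps.
have [h1 e1] := occurs_window oc1 tw; have [h2 e2] := occurs_window oc2 tw.
by exists p1, p2; rewrite /repeated h1 h2 e1 e2 eqxx !andbT; apply/eqP.
Qed.

(** Encoding in a finite type. [insub_bseq] falls back to a default on words longer than [n], so the
    encoding is faithful only under [bounded n P]. *)
Definition word_family n P : {ffun I -> n.-bseq A} :=
  [ffun j => insub_bseq n (relword P j)].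

Definition bounded n P := forall j, size (relword P j) <= n.

Lemma word_familyE n P j :
  bounded n P -> word_family n P j = relword P j :> seq A.
Proof. by move=> Pn; rewrite ffunE /insub_bseq insubdK // unfold_in. Qed.

Lemma word_family_inj n P Q :
  bounded n P -> bounded n Q -> word_family n P = word_family n Q -> P = Q.
Proof.
move=> Pn Qn e.
have e' j : relword P j = relword Q j by rewrite -!(@word_familyE n) // e.
apply: eq_from_tnth => i.
have := e' (i, true); have := e' (i, false); rewrite /relword /=.
by case: (tnth P i) => a b; case: (tnth Q i) => c d /= /val_inj -> /val_inj ->.
Qed.

Lemma word_family_onto n (f : {ffun I -> n.-bseq A}) :
  (forall j, 0 < size (f j)) -> exists2 P, bounded n P & word_family n P = f.
Proof.
move=> f0.
have fP j : (f j : seq A) != [::] by rewrite -size_eq0 -lt0n f0.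
pose w j : nonempty_word A := Sub (f j : seq A) (fP j).
pose P : presentation A k := [tuple (w (i, true), w (i, false)) | i < k].
have PE j : relword P j = f j.
  by case: j => i [] /=; rewrite /relword /= tnth_mktuple.
have Pn : bounded n P by move=> j; rewrite PE size_bseq.
by exists P => //; apply/ffunP => j; apply: val_inj; rewrite /= word_familyE.
Qed.

Lemma card_presentations_le n (X : set (presentation A k))
    (Y : {set {ffun I -> n.-bseq A}}) : finite_set X ->
  (forall P, X P -> bounded n P) ->
  (forall P, X P -> word_family n P \in Y) -> #|` fset_set X| <= #|Y|.
Proof.
move=> finX Xn XY; rewrite cardE -(size_map (word_family n)).
have memX P : P \in enum_fset (fset_set X) -> X P.
  by move=> h; apply/set_mem; rewrite -(in_fset_set finX).
apply: uniq_leq_size.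
  rewrite map_inj_in_uniq ?fset_uniq // => P Q /memX hP /memX hQ.
  by apply: word_family_inj; exact: Xn.
by move=> _ /mapP[P /memX hP ->]; rewrite mem_enum XY.
Qed.

Lemma card_presentations_ge n (X : set (presentation A k))
    (Y : {set {ffun I -> n.-bseq A}}) : finite_set X ->
  (forall f, f \in Y -> exists2 P, X P & word_family n P = f) ->
  #|Y| <= #|` fset_set X|.
Proof.
move=> finX XY; rewrite cardE -(size_map (word_family n)).
apply: uniq_leq_size; first exact: enum_uniq.
move=> f; rewrite mem_enum => /XY[P XP <-]; apply: map_f.
by have := in_fset_set finX P; rewrite mem_set.
Qed.

Lemma exists_sqrt n : exists2 r, r ^ 2 <= n & n < r.+1 ^ 2.
Proof.
elim: n => [|n [r h1 h2]]; first by exists 0.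
by have [h|h] := ltnP n.+1 (r.+1 ^ 2); [exists r|exists r.+1] => //; nia.
Qed.

(** Two one-sided comparisons suffice: the stratum of families is at most as large as [S n], and the
    presentations of [S n] violating the overlap condition inject into [bad]. *)
Lemma generic_small_overlap (R : realType) m
    (L : forall n, {set {ffun I -> 'I_n.+1}})
    (S : nat -> set (presentation A k)) :
  (forall n l, l \in L n -> forall j, 0 < l j) ->
  (forall n P, S n P <-> bounded n P /\ lengths (word_family n P) \in L n) ->
  rare A L m -> generic R S [set P | small_overlap m P]%classic.
Proof.
move=> Lpos SE [C [r0 rareL]].
have Sn n P : S n P -> bounded n P by case/SE.
have finS n : finite_set (S n).
  by apply: sub_finite_set (finite_bounded_presentations A k n) => P /Sn.
pose X : set (presentation A k) := [set P | small_overlap m P]%classic.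
have finI n : finite_set (X `&` S n) by apply: sub_finite_set (finS n) => P [].
have finD n : finite_set (S n `\` X) by apply: sub_finite_set (finS n) => P [].
have count n r : r0 <= r -> 0 < r -> r ^ 2 <= n -> n < r.+1 ^ 2 ->
    0 < #|` fset_set (S n)| /\
    #|` fset_set (S n `\` X)| * r <= C * #|` fset_set (S n)|.
  move=> hr r1 rn nr; have [pos le] := rareL n r hr rn nr.
  have geS : #|stratum A (L n)| <= #|` fset_set (S n)|.
    apply: card_presentations_ge => // f; rewrite inE => fL.
    have [j|P Pn e] := @word_family_onto n f; first by rewrite -lengthsE Lpos.
    by exists P => //; apply/SE; rewrite e.
  have leD : #|` fset_set (S n `\` X)| <= #|bad A (L n) m (5 * r)|.
    apply: card_presentations_le => // P [SP nXP]; first exact: Sn SP.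
    have /SE[Pn PL] := SP; rewrite !inE PL /=.
    have [//|/existsPn long] :=
      boolP [exists j, size (word_family n P j) < m * (5 * r)].
    have eqw : (fun i => word_family n P i : seq A) = relword P.
      by apply/funext => i; rewrite word_familyE.
    apply/asboolP; rewrite eqw.
    apply: (has_repeat_of_not_small_overlap _ _ nXP).
      by rewrite muln_gt0.
    by move=> j; have := long j; rewrite -leqNgt word_familyE.
  split; first exact: leq_trans pos geS.
  apply: (leq_trans (leq_mul leD (leqnn r))); apply: leq_trans le _.
  by rewrite leq_mul2l geS orbT.
rewrite /generic -/X; apply/cvgrPdist_le => e e0.
(* From [r1 ^ 2 <= n < r.+1 ^ 2] follows [r1 <= r], so [r] passes the threshold [r0] and satisfies
   [C / r <= e]. *)
pose r1 := maxn r0.+1 (Num.bound (C%:R / e)).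
exists (r1 ^ 2) => // n /= nr1.
have [r rn nr] := exists_sqrt n.
have r1r : r1 <= r.
  by rewrite -ltnS -(@ltn_exp2r _ _ 2) // (leq_ltn_trans nr1).
have [r0r cr] : r0 < r /\ Num.bound (C%:R / e) <= r.
  by move: r1r; rewrite geq_max => /andP[].
have [pos le] := count n r (ltnW r0r) (leq_ltn_trans (leq0n _) r0r) rn nr.
have leI : #|` fset_set (X `&` S n)| <= #|` fset_set (S n)|.
  by apply: fsubset_leq_card; rewrite -fset_set_sub // => P [].
have split : #|` fset_set (S n)| <=
    #|` fset_set (X `&` S n)| + #|` fset_set (S n `\` X)|.
  rewrite -{1}(setUIDK (S n) X) setIC fset_setU //.
  by rewrite cardfsU leq_subr.
move: pos le leI split; set s := #|` fset_set (S n)|.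
set x := #|` fset_set (X `&` S n)|; set y := #|` _| => pos le leI split.
have s0 : (0 < s%:R :> R)%R by rewrite ltr0n.
have rpos : (0 < r%:R :> R)%R by rewrite ltr0n (leq_ltn_trans _ r0r).
have Cer : (C%:R <= e * r%:R)%R.
  rewrite mulrC -ler_pdivrMr //.
  apply: (@le_trans _ _ ((Num.bound (C%:R / e))%:R)%R).
    by apply/ltW/archi_boundP; rewrite divr_ge0 // ltW.
  by rewrite ler_nat.
(* The distance to 1 is [(s - x) / s], where [x <= s] keeps the natural subtraction exact; it is at
   most [y / s], hence at most [C / r]. *)
have -> : (1 - x%:R / s%:R = (s - x)%:R / s%:R :> R)%R.
  by rewrite natrB // mulrBl divff // gt_eqF.
rewrite ger0_norm ?divr_ge0 // ler_pdivrMr // -(ler_pM2r rpos).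
apply: (@le_trans _ _ (C%:R * s%:R)%R).
  rewrite -!natrM ler_nat; apply: leq_trans le.
  by rewrite leq_mul2r leq_subLR split orbT.
by rewrite mulrAC ler_pM2r.
Qed.

Lemma lengths_word_family n P j :
  bounded n P -> lengths (word_family n P) j = size (relword P j) :> nat.
Proof. by move=> Pn; rewrite lengthsE word_familyE. Qed.

End Presentations.

(** * The two stratifications *)

Local Open Scope classical_set_scope.
Local Open Scope ring_scope.

Theorem corollary4 (R : realType) (A : finType) (m k : nat)
    (hm : (1 <= m)%N) (hk : (1 <= k)%N) (hA : (2 <= #|A|)%N) :
  generic R (@sum_stratification A k) [set P | small_overlap m P] /\
  generic R (@max_stratification A k) [set P | small_overlap m P].
Proof.
have I0 := card_relpos_gt0 hk.
split.
  apply: (@generic_small_overlap A k hA hk R m (@sum_lengths (relpos k))).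
  - by move=> n l; rewrite inE => /andP[/forallP].
  (* Membership in the stratum bounds every relation word by [n], so the encoding keeps all lengths;
     positivity of the lengths is nonemptiness of relation words. *)
  - move=> n P; rewrite inE; split=> [SP|[Pn /andP[_ /eqP]]].
      have Pn : bounded n P.
        by move=> j; rewrite -SP /sum_length (bigD1 j) //= leq_addr.
      split=> //; apply/andP; split.
        by apply/forallP => j; rewrite lengths_word_family ?relword_gt0.
      by apply/eqP; rewrite -[RHS]SP; apply: eq_bigr => j _;
        rewrite lengths_word_family.
    move=> <-; rewrite /sum_stratification /=.
    by apply: eq_bigr => j _; rewrite lengths_word_family.
  - exact: rare_sum.
apply: (@generic_small_overlap A k hA hk R m (@max_lengths (relpos k))).
- by move=> n l; rewrite inE => /andP[/forallP].
- move=> n P; rewrite inE; split=> [SP|[Pn /andP[_ /eqP e]]].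
    have Pn : bounded n P by move=> j; rewrite -SP; exact: (leq_bigmax j).
    split=> //; apply/andP; split.
      by apply/forallP => j; rewrite lengths_word_family ?relword_gt0.
    by apply/eqP; rewrite -[RHS]SP; apply: eq_bigr => j _;
        rewrite lengths_word_family.
  rewrite /max_stratification /= -[RHS]e.
  by apply: eq_bigr => j _; rewrite lengths_word_family.
- exact: rare_max.
Qed.
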